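(* The Continuum Hypothesis implies $$\mathrm{sc}(\{f\in\mathbb{R}^{\mathbb{R}}: f\text{ is Lebesgue measurable}\})=\mathrm{sc}(\{f\in\mathbb{R}^{\mathbb{R}}: f\text{ has the Baire property}\})=\omega_2=(2^{\omega})^{+}.$$
   Context: A function $f:\mathbb{R}\to\mathbb{R}$ has the Baire property if it is measurable with respect to the $\sigma$-algebra generated by the Borel sets and the meager sets. $\kappa^+$ is the successor cardinal of $\kappa$. $\mathbb{R}^{\mathbb{R}}$ is the set of all functions $f:\mathbb{R}\to\mathbb{R}$. A difference operator is a map $D:\mathbb{R}^{\mathbb{R}}\to\mathbb{R}^{\mathbb{R}}$ of the form $(Df)(x)=\sum_{i=1}^n a_i f(x+b_i)$ with $a_i,b_i\in\mathbb{R}$; $\mathcal{D}$ is the set of difference operators. A system of difference equations is a set $S\subset\mathcal{D}\times\mathbb{R}^{\mathbb{R}}$; a function $f:\mathbb{R}\to\mathbb{R}$ is a solution to $S$ if $Df=g$ for every $(D,g)\in S$. A subsystem of $S$ is a subset of $S$. For $\mathcal{F}\subset\mathbb{R}^{\mathbb{R}}$ the solvability cardinal $\mathrm{sc}(\mathcal{F})$ is the minimal cardinal $\kappa$ with the following property: for every system $S$ of difference equations, if every subsystem of $S$ of cardinality less than $\kappa$ has a solution in $\mathcal{F}$, then $S$ has a solution in $\mathcal{F}$. *)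

(* Defs.v *)
From HB Require Import structures.
From mathcomp Require Import all_boot all_order all_algebra.
From mathcomp Require Import all_classical all_reals all_analysis.
From mathcomp Require Import measurable_realfun.

Set Implicit Arguments.
Unset Strict Implicit.
Unset Printing Implicit Defensive.

Import Order.TTheory GRing.Theory Num.Theory.
Import numFieldNormedType.Exports.

Local Open Scope classical_set_scope.
Local Open Scope ring_scope.
Local Open Scope card_scope.

(* A cardinal is represented by a type having that many elements, so an
   equality of cardinals is a statement up to equipotence: the predicates
   [is_aleph n], [is_card_succ K] and [is_sc F] below each determine the type
   they hold of up to [#=] (Cantor-Bernstein). *)

Definition card_lt (T U : Type) (A : set T) (B : set U) : Prop :=
  A #<= B /\ ~ (B #<= A).

(* L = K^+ *)
Definition is_card_succ (K L : Type) : Prop :=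
  card_lt [set: K] [set: L] /\
  forall M : Type, card_lt [set: K] [set: M] -> [set: L] #<= [set: M].

(* K has cardinality omega_n, for finite n *)
Fixpoint is_aleph (n : nat) (K : Type) : Prop :=
  match n with
  | 0%N => [set: K] #= [set: nat]
  | m.+1 => exists L : Type, is_aleph m L /\ is_card_succ L K
  end.

(* [nat -> bool] is the cardinal 2^omega *)
Definition continuum_hypothesis : Prop := is_aleph 1 (nat -> bool).

Definition nowhere_dense (T : topologicalType) (A : set T) : Prop :=
  interior (closure A) = set0.

Definition meager (T : topologicalType) (A : set T) : Prop :=
  exists F : nat -> set T,
    (forall i, nowhere_dense (F i)) /\ A = \bigcup_i F i.

(* In both definitions below the codomain carries the Borel sets, while the
   domain is R with a sigma-algebra larger than the canonical (Borel) one. *)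

(* The sigma-algebra generated by the sets [A `|` N], with A Borel and N
   negligible, is that of the Lebesgue (Caratheodory) measurable sets: see
   [completed_caratheodory_measurable]. *)
Definition lebesgue_measurable_fun (R : realType) (f : R -> R) : Prop :=
  measurable_fun setT
    (f : g_sigma_algebraType (completed_algebra_gen (@lebesgue_measure R)) ->
         measurableTypeR R).

Definition borel_or_meager (R : realType) : set (set R) :=
  (measurable : set (set (measurableTypeR R))) `|` @meager R.

Definition baire_property_fun (R : realType) (f : R -> R) : Prop :=
  measurable_fun setT
    (f : g_sigma_algebraType (@borel_or_meager R) -> measurableTypeR R).

Definition difference_operator (R : realType) (D : (R -> R) -> (R -> R)) :
    Prop :=
  exists (n : nat) (a b : 'I_n -> R),
    D = fun f x => \sum_(i < n) a i * f (x + b i).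

Definition is_system (R : realType)
    (S : set (((R -> R) -> (R -> R)) * (R -> R))) : Prop :=
  forall D g, S (D, g) -> difference_operator D.

Definition is_solution (R : realType)
    (S : set (((R -> R) -> (R -> R)) * (R -> R))) (f : R -> R) : Prop :=
  forall D g, S (D, g) -> D f = g.

Definition solvable_in (R : realType) (F : set (R -> R))
    (S : set (((R -> R) -> (R -> R)) * (R -> R))) : Prop :=
  exists2 f, F f & is_solution S f.

Definition sc_property (R : realType) (F : set (R -> R)) (K : Type) : Prop :=
  forall S : set (((R -> R) -> (R -> R)) * (R -> R)),
    is_system S ->
    (forall S', S' `<=` S -> card_lt S' [set: K] -> solvable_in F S') ->
    solvable_in F S.

(* K = sc(F) *)
Definition is_sc (R : realType) (F : set (R -> R)) (K : Type) : Prop :=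
  sc_property F K /\
  forall L : Type, sc_property F L -> [set: K] #<= [set: L].

(* Main.v *)
Require Import Defs.
From mathcomp Require Import all_boot all_order all_algebra.
From mathcomp Require Import all_classical all_reals all_analysis.
From mathcomp Require Import measurable_realfun wochoice.

Set Implicit Arguments.
Unset Strict Implicit.
Unset Printing Implicit Defensive.

Import Order.TTheory GRing.Theory Num.Theory.
Import numFieldNormedType.Exports.

Local Open Scope classical_set_scope.
Local Open Scope ring_scope.
Local Open Scope card_scope.

(** The solvability cardinal of any class of functions is at most the successor
    of the continuum: once two equations with the same operator are forced to
    agree, a system has at most continuum many equations, because there are
    only continuum many difference operators ([sc_property_card_succ]).

    For the lower bound a single system of size continuum is enough, all of
    whose countable subsystems are solvable in the class although the whole is
    not; under the continuum hypothesis, smaller than the continuum means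
    countable. The system prescribes every difference [f (x + t) - f x] of a
    function [f] of Sierpinski type: its fibres are countable, and each
    translation changes it only at countably many points ([CH_sierpinski]).
    Such an [f] records the first member containing [x] of an increasing chain
    of countable subgroups exhausting the reals, which exists because the
    reals can be well-ordered with countable initial segments.

    Countably many of these equations are solved by a function with countable
    support, hence a Borel function ([shift_subsystem_solvable]). Any solution
    of all of them differs from [f] by a constant, so it is again almost
    invariant with countable fibres. It cannot be measurable: superlevel sets of an almost
    invariant function obey a zero-one law, by Lebesgue's density theorem for
    measure ([lebesgue_zero_one]) and by Baire's theorem for category
    ([baire_zero_one]), so a measurable one would be constant off a small set,
    that is, have a fibre with small complement
    ([not_measurable_almost_invariant]). *)

(** * Well-orders and successor cardinals *)
Definition strict_well_order (X : Type) (lt : X -> X -> Prop) : Prop :=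
  [/\ well_founded lt,
      forall x y z, lt x y -> lt y z -> lt x z
    & forall x y, x <> y -> lt x y \/ lt y x].

Lemma injective_card_le (X Y : Type) (f : X -> Y) :
  injective f -> [set: X] #<= [set: Y].
Proof.
move=> fI; apply: inj_card_le.
suff: $|{injfun [set: X] >-> [set: Y]}| by move/unsquash.
by apply/injfunPex; exists f => // x y _ _; exact: fI.
Qed.

Lemma well_founded_min (X : Type) (lt : X -> X -> Prop) (P : X -> Prop) :
  well_founded lt -> (exists x, P x) ->
  exists x, P x /\ forall y, lt y x -> ~ P y.
Proof.
move=> wf [x0 Px0]; apply: contrapT => noM.
have H x : ~ P x.
  move: x; apply: (well_founded_ind wf) => x IH Px; apply: noM.
  by exists x.
exact: H Px0.
Qed.

Lemma exists_strict_well_order (T : choiceType) :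
  exists lt : T -> T -> Prop, strict_well_order lt.
Proof.
have [R woR] := well_ordering_principle T.
have minR (P : T -> Prop) : (exists x, P x) ->
    exists z, P z /\ forall x, P x -> R z x.
  move=> [x Px]; have [|z [[Pz minz] _]] := woR [pred z | `[< P z >]].
    by exists x; apply/asboolP.
  exists z; split; first exact/asboolP.
  by move=> y Py; apply: minz; apply/asboolP.
have chR : wo_chain R predT by apply: withinW.
have tR x y : R x y || R y x by exact: (wo_chainW chR).
have aR x y : R x y -> R y x -> x = y.
  by move=> xy yx; apply: (wo_chain_antisymmetric chR) => //; rewrite xy yx.
have trR x y z : R x y -> R y z -> R x z.
  move=> xy yz.
  have [w [wE wm]] := minR (fun w => [\/ w = x, w = y | w = z])
    (ex_intro _ x (Or31 _ _ erefl)).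
  have [wx wy wz] : [/\ R w x, R w y & R w z].
    by split; apply: wm; [apply: Or31|apply: Or32|apply: Or33].
  case: wE => ew; subst w => //.
    by rewrite (aR _ _ xy wx).
  by rewrite -(aR _ _ yz wy).
exists (fun x y => R x y /\ x <> y); split.
- move=> x; apply: contrapT => nAx.
  have [z [nz mz]] := minR _ (ex_intro (fun x => ~ Acc _ x) x nAx).
  apply: nz; constructor => y [yz nyz]; apply: contrapT => ny.
  by apply: nyz; apply: aR => //; exact: mz.
- move=> x y z [xy nxy] [yz nyz]; split; first exact: trR xy yz.
  by move=> xz; subst z; apply: nxy; exact: aR.
- move=> x y nxy; have /orP[xy|yx] := tR x y; first by left.
  by right; split => // /esym.
Qed.

(** The power set of [A] is too big to embed into [A]; well-order it and cut it
    off at the first point whose initial segment is too big as well, if there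
    is one. *)
Lemma exists_hartogs (A : pointedType) :
  exists (X : Type) (lt : X -> X -> Prop),
    [/\ strict_well_order lt,
        forall x, [set y | lt y x] #<= [set: A]
      & ~ ([set: X] #<= [set: A])].
Proof.
have [lt [wf tr tot]] := exists_strict_well_order (set A : choiceType).
(* Cantor's diagonal argument, run along an alleged injection of the power set
   into [A]. *)
have big : ~ ([set: set A] #<= [set: A]).
  move=> /pcard_injP[f fI].
  pose D := [set a | exists B, f B = a /\ ~ B a].
  have [DfD|nDfD] := pselect (D (f D)).
    have [B [fB nB]] := DfD.
    by apply: nB; rewrite (fI B D) ?inE.
  by apply: (nDfD); exists D.
have [/(well_founded_min wf)[x [nx mx]]|] := pselect
    (exists x, ~ ([set y | lt y x] #<= [set: A])).
  exists {y | lt y x}, (fun u v => lt (proj1_sig u) (proj1_sig v)); split.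
  - split.
    + move=> [u hu]; elim: {u}(wf u) hu => u _ IH hu.
      by constructor => -[v hv] /= vu; exact: IH.
    + by move=> u v w; exact: tr.
    + move=> [u hu] [v hv] /= nuv; apply: tot => uv; apply: nuv.
      by subst v; congr exist; exact: Prop_irrelevance.
  - move=> [y hy] /=.
    have /pcard_injP[f fI] : [set z | lt z y] #<= [set: A].
      by apply: contrapT; exact: mx.
    apply/pcard_injP; exists (f \o @proj1_sig _ _).
    move=> [u hu] [v hv]; rewrite !inE /= => uy vy /fI; rewrite !inE /=.
    move=> /(_ uy vy) uv; subst v; congr exist; exact: Prop_irrelevance.
  - move=> /pcard_injP[f fI]; apply: nx; apply/pcard_injP.
    exists (fun y => if pselect (lt y x) is left h then f (exist _ y h) else point).
    move=> u v; rewrite !inE /= => ux vx.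
    case: pselect => // hu; case: pselect => // hv /fI; rewrite !inE.
    by move=> /(_ Logic.I Logic.I) [].
move=> /forallNP nex; exists (set A), lt; split => // x.
apply: contrapT; exact: nex.
Qed.

(** Transfinite recursion: at each stage the image of the initial segment is no
    bigger than [A], hence misses a point of [M], which becomes the next value.
    Both the comparability of cardinals and the minimality of successor
    cardinals follow from this. *)
Lemma transfinite_card_le (X : Type) (lt : X -> X -> Prop) (A M : Type) :
  strict_well_order lt -> (forall x, [set y | lt y x] #<= [set: A]) ->
  ~ ([set: M] #<= [set: A]) -> [set: X] #<= [set: M].
Proof.
move=> [wf tr tot] segA nMA.
have /choice[fresh freshP] (B : set M) :
    exists m, B #<= [set: A] -> ~ B m.
  apply: contrapT => /forallNP noM; apply: nMA.
  have [BA|nBA] := pselect (B #<= [set: A]); last first.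
    have [m|m0] := pselect (exists m : M, True).
      by case: m => m _; case: (noM m).
    suff -> : [set: M] = set0 by exact: card_ge0.
    by apply/seteqP; split => // m _; apply: m0; exists m.
  suff -> : [set: M] = B by [].
  apply/seteqP; split => // m _; apply: contrapT => Bm.
  by apply: (noM m).
pose step x (rec : forall y, lt y x -> M) :=
  fresh [set m | exists y (h : lt y x), m = rec y h].
pose g := Fix wf (fun=> M) step.
have gE x : g x = fresh (g @` [set y | lt y x]).
  rewrite /g Fix_eq; last first.
    move=> y f1 f2 f12; rewrite /step; congr fresh.
    by apply/seteqP; split => m [z [h ->]]; exists z, h; rewrite f12.
  rewrite /step; congr fresh; apply/seteqP; split.
    by move=> m [y [h ->]]; exists y.
  by move=> m [y h <-]; exists y, h.
have gN x y : lt y x -> g y <> g x.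
  move=> yx gyx.
  have : ~ (g @` [set y | lt y x]) (g x).
    rewrite gE; apply: freshP; apply: card_le_trans (segA x).
    exact: card_image_le.
  by apply; exists y.
apply: (injective_card_le (f := g)) => x y gxy; apply: contrapT => nxy.
by case: (tot _ _ nxy) => /gN; apply.
Qed.

(** All initial segments of a well-order of [A] trivially embed into [A], so
    the recursion exhausts [A] itself. *)
Lemma card_le_of_not_ge (A : choiceType) (M : Type) :
  ~ ([set: M] #<= [set: A]) -> [set: A] #<= [set: M].
Proof.
have [lt ltW] := exists_strict_well_order A.
by move=> nMA; apply: (transfinite_card_le ltW) nMA => x; exact: card_leT.
Qed.

Lemma exists_card_succ (A : pointedType) : exists K : Type, is_card_succ A K.
Proof.
have [K [lt [ltW segA nKA]]] := exists_hartogs A.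
exists K; split; first by split => //; exact: card_le_of_not_ge.
by move=> M [_ nMA]; exact: transfinite_card_le ltW segA nMA.
Qed.

(** * Additive groups with countably many generators *)

(** The additive subgroup generated by [A], as signed sums of finite sequences:
    in this form it is the image of a set of codes, countable when [A] is. *)
Definition zspan (V : zmodType) (A : set V) : set V :=
  (fun s : seq (bool * V) => \sum_(u <- s) (if u.1 then u.2 else - u.2)) @`
    [set s | forall u, u \in s -> A u.2].

Lemma sub_zspan (V : zmodType) (A : set V) : A `<=` zspan A.
Proof.
move=> x Ax; exists [:: (true, x)]; last by rewrite big_seq1.
by move=> u; rewrite inE => /eqP->.
Qed.

Lemma zspanD (V : zmodType) (A : set V) x y :
  zspan A x -> zspan A y -> zspan A (x + y).
Proof.
move=> [s sA <-] [r rA <-]; exists (s ++ r); last by rewrite big_cat.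
by move=> u; rewrite mem_cat => /orP[/sA|/rA].
Qed.

Lemma zspanN (V : zmodType) (A : set V) x : zspan A x -> zspan A (- x).
Proof.
move=> [s sA <-]; exists [seq (~~ u.1, u.2) | u <- s].
  by move=> u /mapP[v /sA vA ->].
rewrite big_map -sumrN; apply: eq_bigr => -[[] v] _ //=.
by rewrite opprK.
Qed.

Lemma zspanS (V : zmodType) (A B : set V) :
  A `<=` B -> zspan A `<=` zspan B.
Proof. by move=> AB; apply: image_subset => s sA u /sA/AB. Qed.

Lemma countable_zspan (V : zmodType) (A : set V) :
  countable A -> countable (zspan A).
Proof.
move=> /countable_injP[e eI]; apply: card_le_trans (card_image_le _ _) _.
apply/countable_injP.
exists (fun s => choice.pickle [seq (u.1, e u.2) | u <- s]).
move=> s r; rewrite !inE => sA rA /(pcan_inj choice.pickleK).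
elim: s r sA rA => [|[b x] s IH] [|[c y] r] //= sA rA [-> exy sr].
have -> : x = y.
  by apply: eI => //; rewrite inE; [apply: (sA (b, x))|apply: (rA (c, y))];
    rewrite mem_head.
congr cons; apply: IH sr => u us; [apply: sA|apply: rA];
  by rewrite inE us orbT.
Qed.

(** * An almost invariant function with countable fibres *)

(** A real is determined by the set of rationals below it. *)
Lemma card_real_le (R : realType) : [set: R] #<= [set: nat -> bool].
Proof.
pose cut (x : R) (n : nat) :=
  if choice.unpickle n is Some q then ratr (q : rat) < x else false.
have cutN (x y : R) : x < y -> cut x <> cut y.
  move=> xy.
  have [q] := rat_in_itvoo xy; rewrite in_itv/= => /andP[xq qy].
  move=> /(congr1 (@^~ (choice.pickle q))); rewrite /cut choice.pickleK qy.
  by rewrite ltNge (ltW xq).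
apply: (injective_card_le (f := cut)) => x y cxy.
by have [/cutN/(_ cxy)|/cutN/(_ (esym cxy))|] := ltgtP x y.
Qed.

(** An uncountable well-order with countable initial segments has, under the
    continuum hypothesis, at least continuum many points, so the reals embed
    into it and inherit its order. *)
Lemma CH_well_order (R : realType) : continuum_hypothesis ->
  exists lt : R -> R -> Prop,
    strict_well_order lt /\ forall x, countable [set y | lt y x].
Proof.
move=> [L [LN [_ succL]]].
have [X [lt [[wf tr tot] segN nXN]]] := exists_hartogs nat.
have [j jI] : exists j : R -> X, injective j.
  have : [set: R] #<= [set: X].
    apply: card_le_trans (card_real_le R) _; apply: succL.
    split; last by rewrite (card_le_eqr LN).
    rewrite (card_le_eql LN); apply/infiniteP => /finite_set_countable.
    exact: nXN.
  move=> /card_leP[f]; exists (fun x => val (f (to_setT x))) => x y.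
  move=> /val_inj /inj; rewrite !inE => /(_ Logic.I Logic.I) /(congr1 val).
  by [].
exists (fun x y => lt (j x) (j y)); split.
  split.
  (* Accessibility of [x] is proved by recursion on its image [j x]. *)
  - move=> x; move: {-1}(j x) (erefl (j x)) => i.
    elim: {i}(wf i) x => i _ IH x ji; constructor => y yx.
    by apply: IH (erefl (j y)); rewrite -ji.
  - by move=> x y z; exact: tr.
  - by move=> x y nxy; apply: tot => /jI.
move=> x; have /countable_injP[e eI] := segN (j x).
apply/countable_injP; exists (e \o j) => y z; rewrite !inE /= => yx zx.
by move=> /eI yz; apply/jI/yz; rewrite inE.
Qed.

Definition countable_fibres (R : realType) (f : R -> R) : Prop :=
  forall y, countable (f @^-1` [set y]).

(** Countable sets are both null and meager, so this one notion serves measure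
    and category. *)
Definition almost_invariant (R : realType) (f : R -> R) : Prop :=
  forall t, countable [set x | f (x + t) <> f x].

(** The reals are the union of the increasing chain of countable groups [G y]
    generated by the points up to [y], and [f x] is the first [y] with [x] in
    [G y]. A fibre lies in one of these groups. If [x] is not in [G t], then
    [f x] is at least [t], so [t] and [- t] lie in the groups indexed by [f x]
    and [f (x + t)], and translating by them cannot raise the index: thus
    [f (x + t) = f x] outside [G t]. *)
Lemma CH_sierpinski (R : realType) : continuum_hypothesis ->
  exists f : R -> R,
    countable_fibres f /\ almost_invariant f.
Proof.
move=> /(CH_well_order R)[lt [[wf tr tot] segC]].
pose le x y := lt x y \/ x = y.
have leT x y z : le x y -> le y z -> le x z.
  move=> [xy|->] // [yz|<-]; last by left.
  by left; exact: tr yz.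
pose G y := zspan [set z | le z y].
have GC y : countable (G y).
  apply: countable_zspan.
  have -> : [set z | le z y] = [set z | lt z y] `|` [set y] by [].
  by rewrite -bigcup2E; apply: bigcup_countable => // -[|[|]] //= _.
have Gmem y : G y y by apply: sub_zspan; right.
have Gmono y z : le y z -> G y `<=` G z.
  by move=> yz; apply: zspanS => w /= wy; exact: leT yz.
have /choice[f fP] (x : R) : exists y, G y x /\ forall z, lt z y -> ~ G z x.
  by apply: (well_founded_min wf); exists x.
have fle x y : G y x -> le (f x) y.
  move=> Gyx; have [->|/eqP/tot[fxy|yfx]] := eqVneq (f x) y; [by right|by left|].
  by have [_ /(_ _ yfx)] := fP x.
have anti x y : le x y -> le y x -> x = y.
  move=> [xy|//] [yx|//]; exfalso.
  by elim: {x}(wf x) y xy yx => x _ IH y xy yx; exact: (IH _ yx _ yx xy).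
exists f; split => [y|t].
  apply: sub_countable (GC y); apply: subset_card_le => x /= <-.
  by have [] := fP x.
apply: sub_countable (GC t); apply: subset_card_le => x /= fxt.
apply: contrapT => nGx; apply: fxt.
have ltf z : ~ G t z -> le t (f z).
  move=> nGz; have [->|/eqP/tot[fz|tfz]] := eqVneq (f z) t; [by right| |by left].
  by case: nGz; apply: Gmono (fP z).1; left.
have shift z u : G (f z) u -> le (f (z + u)) (f z).
  by move=> Gu; apply: fle; apply: zspanD => //; have [] := fP z.
have tx : G (f x) t by apply: Gmono (Gmem t); exact: ltf.
have nGxt : ~ G t (x + t).
  move=> Gxt; apply: nGx; rewrite -(addrK t x); apply: zspanD => //.
  exact: zspanN (Gmem t).
have txt : G (f (x + t)) (- t).
  by apply: zspanN; apply: Gmono (Gmem t); exact: ltf.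
apply: anti; first exact: shift.
by have := shift _ _ txt; rewrite addrK.
Qed.

(** * A zero-one law for Lebesgue measure *)
Lemma measurable_addr (R : realType) (t : R) :
  measurable_fun setT
    ((fun x => x + t) : measurableTypeR R -> measurableTypeR R).
Proof. by apply: measurable_funD => //; exact: measurable_cst. Qed.

Lemma measurable_shift (R : realType) (t : R) (A : set R) :
  measurable A -> measurable [set x | A (x + t)].
Proof. by move=> mA; rewrite -[X in measurable X]setTI; exact: measurable_addr. Qed.

(** The measure transported along the translation agrees with Lebesgue measure
    on half-open intervals, hence everywhere by uniqueness. *)
Lemma lebesgue_measure_shift (R : realType) (t : R) (A : set R) :
  measurable A ->
  lebesgue_measure [set x | A (x + t)] = lebesgue_measure A.
Proof.
move=> mA.
suff : pushforward lebesgue_measure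
    ((fun x => x + t) : measurableTypeR R -> measurableTypeR R) A =
  lebesgue_measure A by [].
apply/esym/lebesgue_measure_unique => //.
  exact: measurable_addr.
move=> mt _ [[a b]] _ <- /=.
rewrite /pushforward (_ : _ @^-1` _ = `]a - t, b - t]%classic).
  rewrite !lebesgue_measure_itv/= !lte_fin ltrD2r; case: ifP => // _.
  by rewrite -!EFinD; congr EFin; rewrite opprD opprK addrACA addNr addr0.
by apply/seteqP; split => x /=; rewrite !in_itv/= ltrBlDr lerBrDr.
Qed.

(** By the density theorem almost every point of [A] has density 1, so that
    eventually more than half of the interval of length [2 r] around it, that
    is, more than [r], is occupied. *)
Lemma density_point (R : realType) (A : set R) : measurable A ->
  lebesgue_measure A <> 0%E ->
  exists x, A x /\
    \forall r \near 0^'+, (r%:E < lebesgue_measure (A `&` ball x r))%E.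
Proof.
move=> mA A0; have [N [mN N0 sN]] := lebesgue_density mA.
have [x [Ax nNx]] : exists x, A x /\ ~ N x.
  apply: contrapT => noX; apply: A0; apply/negligibleP => //.
  exists N; split => // x Ax.
  by apply: contrapT => nNx; apply: noX; exists x.
exists x; split => //.
have : (lebesgue_measure (A `&` ball x r) * (lebesgue_measure (ball x r))^-1
    @[r --> 0^'+] --> (\1_A x)%:E)%E.
  by apply: contrapT => nx; apply: nNx; apply: sN.
rewrite indicE mem_set//= => cv.
have /cv half : nbhs (1 : \bar R)%E [set y | ((2^-1)%:E < y)%E].
  apply: open_nbhs_nbhs; split; first exact: open_ereal_gt_ereal.
  by rewrite /= lte_fin invf_lt1// ltr1n.
apply: filterS (filterI (nbhs_right_gt 0) half) => r [r0] /=.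
rewrite lebesgue_measure_ball ?(ltW r0)// inver ?mulrn_eq0/=.
rewrite gt_eqF// lte_pdivlMr ?mulrn_wgt0//.
by rewrite -EFinM -[r *+ 2]mulr_natl mulrA mulVf ?mul1r// pnatr_eq0.
Qed.

(** Move a density point of [A] onto a density point of [B]: on a short interval
    each of the two sets then fills more than half, so they overlap in positive
    measure. *)
Lemma steinhaus (R : realType) (A B : set R) : measurable A -> measurable B ->
  (forall t, lebesgue_measure (A `&` [set x | B (x + t)]) = 0%E) ->
  lebesgue_measure A = 0%E \/ lebesgue_measure B = 0%E.
Proof.
move=> mA mB AB0.
have [|A0] := pselect (lebesgue_measure A = 0%E); first by left.
have [|B0] := pselect (lebesgue_measure B = 0%E); first by right.
have [x [_ dx]] := density_point mA A0.
have [y [_ dy]] := density_point mB B0.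
exfalso.
have [r [[r0 xr] yr]] := filter_ex (filterI (filterI (nbhs_right_gt 0) dx) dy).
pose t := y - x.
pose C := [set z | (B `&` ball y r) (z + t)].
have mbx : measurable (ball x r) by exact: measurable_ball.
have mA' : measurable (A `&` ball x r) by exact: measurableI.
have mB' : measurable (B `&` ball y r).
  by apply: measurableI => //; exact: measurable_ball.
have mC : measurable C.
  exact: measurable_shift mB'.
have Cx : C `<=` ball x r.
  move=> z [_]; rewrite /ball/= => h.
  by rewrite (_ : x - z = y - (z + t)) // [z + t]addrC opprD addrA subKr.
have Cr : (r%:E < lebesgue_measure C)%E.
  by move: yr; rewrite -(lebesgue_measure_shift t mB').
have : (lebesgue_measure (C `\` A) + lebesgue_measure (A `&` ball x r)
     <= lebesgue_measure (ball x r))%E.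
  rewrite -measureU//.
  - apply: le_measure; rewrite ?inE//.
    + by apply: measurableU => //; exact: measurableD.
    + by move=> z [[/Cx]|[]].
  - exact: measurableD.
  - by apply/seteqP; split => // z [[_ nAz] []].
(* The overlap is null by hypothesis, so removing [A] from [C] costs nothing and
   the two halves have to fit side by side. *)
have -> : lebesgue_measure (C `\` A) = lebesgue_measure C.
  have CAz : lebesgue_measure (C `&` A) = 0%E.
    apply/negligibleP; first exact: measurableI.
    exists (A `&` [set x | B (x + t)]); split; [|exact: AB0|].
      by apply: measurableI => //; exact: measurable_shift.
    by move=> z [[Bz _] Az].
  apply/esym/(etrans (measureDI lebesgue_measure mC mA)).
  by rewrite [X in (_ + X)%E]CAz adde0.
rewrite lebesgue_measure_ball ?(ltW r0)// leNgt => /negP; apply.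
by rewrite mulr2n EFinD lteD.
Qed.

Lemma completed_lebesgue_measurableE (R : realType) :
  <<s completed_algebra_gen (@lebesgue_measure R) >> =
    completed_algebra_gen (@lebesgue_measure R).
Proof. exact: g_sigma_completed_algebra_genE. Qed.

(** Steinhaus' theorem applied to the Borel parts of [A] and of its complement:
    every translate of one meets the other in a countable set. *)
Lemma lebesgue_zero_one (R : realType) (A : set R) :
  <<s completed_algebra_gen (@lebesgue_measure R) >> A ->
  (forall t, countable [set x | A x /\ ~ A (x + t)]) ->
  lebesgue_measure.-negligible A \/ lebesgue_measure.-negligible (~` A).
Proof.
move=> mA Ainv.
have : <<s completed_algebra_gen (@lebesgue_measure R) >> (~` A).
  by rewrite -setTD; exact: sigma_algebraCD.
move: mA; rewrite completed_lebesgue_measurableE.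
move=> [B mB [N negN BN]] [C mC [N' negN' CN]].
have [t||] := @steinhaus _ B C mB mC.
- apply: countable_lebesgue_measure0; apply: sub_countable (Ainv t).
  apply: subset_card_le => x [/= Bx Cx]; split; first by rewrite -BN; left.
  by have : (~` A) (x + t) by rewrite -CN; left.
- move=> B0; left; rewrite -BN; apply: negligibleU => //.
  by apply/negligibleP.
- move=> C0; right; rewrite -CN; apply: negligibleU => //.
  by apply/negligibleP.
Qed.

(** * A zero-one law for category *)
Lemma nowhere_denseP (T : topologicalType) (A : set T) :
  nowhere_dense A <-> forall O, open O -> O `<=` closure A -> O = set0.
Proof.
split=> [A0 O oO OA|H]; last by apply: H; [exact: open_interior|exact: interior_subset].
by apply/seteqP; split => //; rewrite -A0 -open_subsetE.
Qed.

Lemma nowhere_denseS (T : topologicalType) (A B : set T) :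
  A `<=` B -> nowhere_dense B -> nowhere_dense A.
Proof.
move=> AB /nowhere_denseP Bnd; apply/nowhere_denseP => O oO OA.
by apply: Bnd => // x /OA; exact: closureS.
Qed.

Lemma meagerS (T : topologicalType) (A B : set T) :
  A `<=` B -> meager B -> meager A.
Proof.
move=> AB [F [Fnd BF]]; exists (fun i => A `&` F i); split.
  by move=> i; apply: nowhere_denseS (Fnd i) => x [].
by rewrite -setI_bigcupr -BF; apply/esym/setIidPl.
Qed.

Lemma nowhere_dense_meager (T : topologicalType) (A : set T) :
  nowhere_dense A -> meager A.
Proof.
move=> And; exists (fun=> A); split => //.
by apply/seteqP; split => [x Ax|x [_ _]//]; exists 0%N.
Qed.

Lemma meager_bigcup (T : topologicalType) (F : nat -> set T) :
  (forall n, meager (F n)) -> meager (\bigcup_n F n).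
Proof.
move=> /choice[G GP].
exists (fun k => if choice.unpickle k is Some (n, i) then G n i else set0).
split.
  move=> k; case: choice.unpickle => [[n i]|]; first exact: (GP n).1.
  by apply/nowhere_denseP => O oO; rewrite closure0 subset0.
apply/seteqP; split => x.
  move=> [n _]; rewrite (GP n).2 => -[i _ Gx].
  by exists (choice.pickle (n, i)) => //; rewrite choice.pickleK.
move=> [k _]; case: choice.unpickle => [[n i] Gx|//].
by exists n => //; rewrite (GP n).2; exists i.
Qed.

Lemma meagerU (T : topologicalType) (A B : set T) :
  meager A -> meager B -> meager (A `|` B).
Proof.
move=> mA mB; rewrite -bigcup2E; apply: meager_bigcup => -[|[|n]] //=.
apply: nowhere_dense_meager.
by apply/nowhere_denseP => O oO; rewrite closure0 subset0.
Qed.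

(** An open set inside the closure of the frontier of [U] avoids [U], yet all its
    points are adherent to [U]. *)
Lemma meager_frontier (T : topologicalType) (U : set T) :
  open U -> meager (closure U `\` U).
Proof.
move=> oU; apply: nowhere_dense_meager; apply/nowhere_denseP => O oO OU.
have OcU : O `<=` ~` U.
  move=> x /OU clx; rewrite (closure_id (~` U)).1; last by rewrite closedC.
  by move: x clx; apply: closureS => y [].
apply/seteqP; split => // x Ox.
have : closure U x.
  rewrite (closure_id (closure U)).1; last exact: closed_closure.
  by move: (OU _ Ox); apply: closureS => y [].
move=> /(_ _ (open_nbhs_nbhs (conj oO Ox)))[y [Uy /OcU]].
exact.
Qed.

(** Baire's theorem: the complements of the closures of the nowhere dense pieces
    are dense open sets, and their intersection would meet [U]. *)
Lemma open_meager0 (R : realType) (U : set R) :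
  open U -> meager U -> U = set0.
Proof.
move=> oU [F [Fnd UF]]; apply: contrapT => /eqP/set0P U0.
have [|x [Ux xF]] := @Baire R R^o (fun i => ~` closure (F i)) _ U U0 oU.
  move=> i; split; first by rewrite openC; exact: closed_closure.
  move=> O O0 oO; apply: contrapT => nO; move/set0P : O0 => /eqP; apply.
  move: (Fnd i) => /nowhere_denseP; apply => // x Ox.
  by apply: contrapT => nFx; apply: nO; exists x.
by move: Ux; rewrite UF => -[i _ Fx]; apply: (xF i Logic.I); exact: subset_closure.
Qed.

Lemma countable_meager (R : realType) (A : set R) : countable A -> meager A.
Proof.
move=> /countable_injP[e eI].
suff -> : A = \bigcup_n [set x | A x /\ e x = n].
  apply: meager_bigcup => n; have [[x [Ax ex]]|nx] :=
    pselect (exists x, A x /\ e x = n).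
    apply: (@meagerS _ _ [set x]).
      by move=> y [Ay ey]; apply: eI; rewrite ?inE// ex.
    apply: nowhere_dense_meager; apply/nowhere_denseP => O oO.
    rewrite -(closure_id _).1; last by rewrite -set_itv1; exact: interval_closed.
    move=> Ox; apply: contrapT => /eqP/set0P O0.
    have [y [Oy /= yx]] := dense_set1C x O0 oO.
    by apply: yx; exact: Ox.
  apply: (@meagerS _ _ set0) => [y Ay|]; first by case: nx; exists y.
  by apply: nowhere_dense_meager; apply/nowhere_denseP => O _; rewrite closure0 subset0.
by apply/seteqP; split => [x Ax|x [n _ []]//]; exists (e x).
Qed.

Lemma open_shift (R : realType) (t : R) (U : set R) :
  open U -> open [set x | U (x + t)].
Proof.
by apply: open_comp => x _; apply: (@cvgD _ R^o); [exact: cvg_id|exact: cvg_cst].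
Qed.

Lemma meager_shift (R : realType) (t : R) (A : set R) :
  meager A -> meager [set x | A (x + t)].
Proof.
move=> [F [Fnd AF]]; exists (fun i => [set x | F i (x + t)]); split; last first.
  by rewrite AF.
move=> i; apply/nowhere_denseP => O oO OF.
have OE : O = [set x | [set y | O (y - t)] (x + t)].
  by apply/seteqP; split => x /=; rewrite addrK.
have cF : closed [set x | closure (F i) (x + t)].
  rewrite -openC (_ : ~` _ = [set x | (~` closure (F i)) (x + t)])//.
  by apply: open_shift; rewrite openC; exact: closed_closure.
have sF : [set y | O (y - t)] `<=` closure (F i).
  move=> y /OF cly.
  have : [set x | closure (F i) (x + t)] (y - t); last by rewrite /= subrK.
  rewrite ((closure_id _).1 cF); move: cly; apply: closureS => x /= Fx.
  exact: subset_closure.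
by rewrite OE (_ : [set y | O (y - t)] = set0)//;
  move: (Fnd i) => /nowhere_denseP; apply => //; exact: open_shift.
Qed.

(** Sets equal to an open set up to a meager set; every set with the Baire property
    is of this form, which gives a concrete handle on the generated
    sigma-algebra. *)
Definition almost_open (R : realType) (A : set R) : Prop :=
  exists2 U : set R, open U & meager ((A `\` U) `|` (U `\` A)).

(** If [A] is close to [U], its complement is close to the exterior of [U]: what
    is lost is the frontier of [U], a meager set. *)
Lemma almost_openC (R : realType) (A : set R) :
  almost_open A -> almost_open (~` A).
Proof.
move=> [U oU mAU]; exists (~` closure U).
  by rewrite openC; exact: closed_closure.
apply: meagerS (meagerU mAU (meager_frontier oU)) => x.
move=> [[nAx /contrapT clUx]|[nUx /contrapT Ax]].
  have [Ux|nUx] := pselect (U x); first by left; right.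
  by right.
by left; left; split => // Ux; apply: nUx; exact: subset_closure.
Qed.

Lemma almost_open_bigcup (R : realType) (F : nat -> set R) :
  (forall n, almost_open (F n)) -> almost_open (\bigcup_n F n).
Proof.
move=> FP.
have /choice[U UP] n : exists U : set R,
    open U /\ meager ((F n `\` U) `|` (U `\` F n)).
  by have [U oU mU] := FP n; exists U.
exists (\bigcup_n U n); first by apply: bigcup_open => n _; exact: (UP n).1.
apply: meagerS (meager_bigcup (fun n => (UP n).2)) => x.
move=> [[[n _ Fx] nU]|[[n _ Ux] nF]]; exists n => //.
  by left; split => // Ux; apply: nU; exists n.
by right; split => // Fx; apply: nF; exists n.
Qed.

Lemma baire_almost_open (R : realType) (A : set R) :
  <<s @borel_or_meager R >> A -> almost_open A.
Proof.
have mO (B : set R) : meager B -> almost_open B.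
  move=> mB; exists set0; first exact: open0.
  by rewrite setD0 set0D setU0.
have sO : sigma_algebra setT (@almost_open R).
  split => [|B /almost_openC|F]; [|by rewrite setTD|exact: almost_open_bigcup].
  by apply: mO; apply: countable_meager.
apply: smallest_sub => // B [mB|]; last exact: mO.
move: B mB; apply: smallest_sub => // _ [[a b] _ <-] /=.
exists `]a, b[%classic; first exact: interval_open.
apply: (@meagerS _ _ [set b]); last exact: countable_meager.
move=> x /=; rewrite !in_itv/= => -[[/andP[ax xb] /negP]|[/andP[ax xb] /negP]].
  by rewrite ax/= -leNgt => bx; apply/eqP; rewrite eq_le xb bx.
by rewrite ax (ltW xb).
Qed.

(** Let [A] and its complement be close to the open sets [U] and [V]. If both are
    nonempty, some translate of [V] meets [U] in a nonempty open set; almost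
    invariance makes this set meager, against Baire's theorem. *)
Lemma baire_zero_one (R : realType) (A : set R) :
  <<s @borel_or_meager R >> A ->
  (forall t, countable [set x | A x /\ ~ A (x + t)]) ->
  meager A \/ meager (~` A).
Proof.
move=> /baire_almost_open aoA Ainv.
have [V oV mV] := almost_openC aoA; have [U oU mU] := aoA.
have [U0|/set0P[u Uu]] := eqVneq U set0.
  by left; apply: meagerS mU => x Ax; left; rewrite U0 setD0.
have [V0|/set0P[v Vv]] := eqVneq V set0.
  by right; apply: meagerS mV => x Ax; left; rewrite V0 setD0.
exfalso; pose t := v - u.
suff : U `&` [set x | V (x + t)] = set0.
  move=> /seteqP[/(_ u) + _]; apply; split => //=.
  by rewrite /t subrKC.
apply: open_meager0; first by apply: openI => //; exact: open_shift.
apply: meagerS (meagerU (meagerU mU (meager_shift t mV))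
  (countable_meager (Ainv t))) => x [Ux Vx].
have [Ax|nAx] := pselect (A x); last by left; left; right.
have [Axt|nAxt] := pselect (A (x + t)); last by right.
by left; right; right; split => //; exact.
Qed.

(** * Almost invariant functions with countable fibres are not measurable *)

(** [I] stands for the ideal of null or meager sets, [M] for the measurable
    sets. By the zero-one law, for each rational [q] either the set where
    [q < f] or its complement is small. Off the union of these small sets [f]
    takes at most one value, since a rational separates any two; so the rest
    lies in a single fibre, is countable, and the whole line is small. *)
Lemma not_measurable_almost_invariant (R : realType) (M I : set (set R))
    (f : R -> R) :
  (forall A, countable A -> I A) ->
  (forall A B, A `<=` B -> I B -> I A) ->
  (forall F : nat -> set R, (forall n, I (F n)) -> I (\bigcup_n F n)) ->
  ~ I setT ->
  (forall A, M A -> (forall t, countable [set x | A x /\ ~ A (x + t)]) ->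
     I A \/ I (~` A)) ->
  countable_fibres f -> almost_invariant f ->
  ~ (forall y, M [set x | y < f x]).
Proof.
move=> Ic IS IU nIT M01 fC fI fM.
have /choice[N NP] n : exists N : set R, I N /\
    forall q : rat, choice.unpickle n = Some q ->
      N = [set x | ratr q < f x] \/ N = ~` [set x | ratr q < f x].
  case: (choice.unpickle n) => [q|]; last first.
    by exists set0; split => //; exact: Ic.
  have [|IA|IA] := M01 _ (fM (ratr q)).
  - move=> t; apply: sub_countable (fI t); apply: subset_card_le => x /=.
    by move=> [qf qft] fxt; apply: qft; rewrite fxt.
  - by exists [set x | ratr q < f x]; split => // _ [<-]; left.
  - by exists (~` [set x | ratr q < f x]); split => // _ [<-]; right.
have fcst x y : ~ (\bigcup_n N n) x -> ~ (\bigcup_n N n) y -> ~ f x < f y.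
  move=> nx ny; move=> xy.
  have [q] := rat_in_itvoo xy; rewrite in_itv/= => /andP[xq qy].
  have [_ /(_ q)] := NP (choice.pickle q).
  rewrite choice.pickleK => /(_ erefl)[] NE.
    by apply: ny; exists (choice.pickle q); rewrite // NE.
  apply: nx; exists (choice.pickle q); rewrite // NE /=.
  by apply/negP; rewrite -leNgt ltW.
have cC : countable (~` \bigcup_n N n).
  have [->//|/set0P[x nx]] := eqVneq (~` \bigcup_n N n) set0.
  apply: sub_countable (fC (f x)); apply: subset_card_le => y ny /=.
  by have [/(fcst _ _ ny nx)|/(fcst _ _ nx ny)|] := ltgtP (f y) (f x).
(* The countable remainder is put in front of the sequence of small sets. *)
apply: nIT; pose F n := if n is k.+1 then N k else ~` \bigcup_n N n.
have : I (\bigcup_n F n).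
  by apply: IU => -[|n] /=; [exact: Ic|exact: (NP n).1].
apply: IS => x _; have [[n _ Nx]|nx] := pselect ((\bigcup_n N n) x).
  by exists n.+1.
by exists 0%N.
Qed.

Lemma g_sigma_measurable_ray (R : realType) (G : set (set R)) (f : R -> R) :
  measurable_fun setT (f : g_sigma_algebraType G -> measurableTypeR R) ->
  forall y, <<s G >> [set x | y < f x].
Proof.
move=> mf y.
have mr : measurable (`]y, +oo[%classic : set (measurableTypeR R)) by [].
have := mf measurableT _ mr.
by rewrite setTI set_itvoy.
Qed.

Lemma countable_support_measurable (R : realType) (G : set (set R))
    (h : R -> R) :
  (measurable : set (set (measurableTypeR R))) `<=` G ->
  countable [set x | h x <> 0] ->
  measurable_fun setT (h : g_sigma_algebraType G -> measurableTypeR R).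
Proof.
move=> BG hC _ B mB; rewrite setTI; apply: sub_sigma_algebra; apply: BG.
have cM (A : set R) : countable A -> measurable (A : set (measurableTypeR R)).
  by apply: countable_measurable => t; exact: measurable_set1.
have [B0|nB0] := pselect (B 0).
  rewrite -[X in measurable X]setCK; apply: measurableC; apply: cM.
  apply: sub_countable hC; apply: subset_card_le => x /= nBh h0.
  by apply: nBh; rewrite /preimage/= h0.
apply: cM; apply: sub_countable hC; apply: subset_card_le => x /= Bh h0.
by apply: nB0; rewrite -h0.
Qed.

Lemma sierpinski_not_lebesgue_measurable (R : realType) (f : R -> R) :
  countable_fibres f -> almost_invariant f ->
  ~ lebesgue_measurable_fun f.
Proof.
move=> fC fI /g_sigma_measurable_ray; move: fC fI.
have cN (A : set R) : countable A -> lebesgue_measure.-negligible A.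
  move=> cA; apply/negligibleP; last exact: countable_lebesgue_measure0.
  by apply: countable_measurable cA => t; exact: measurable_set1.
apply: (not_measurable_almost_invariant (I := lebesgue_measure.-negligible)).
- exact: cN.
- by move=> A B AB; exact: negligibleS.
- by move=> F; exact: negligible_bigcup.
- move=> nT; have : lebesgue_measure.-negligible (`[0, 1]%classic : set R).
    exact: negligibleS nT.
  move=> /negligibleP => /(_ (measurable_itv _)) m0.
  have := etrans (esym m0) (lebesgue_measure_itv `[0, 1]).
  by rewrite /= lte_fin ltr01 sube0 => /esym/eqP; rewrite onee_eq0.
- exact: lebesgue_zero_one.
Qed.

Lemma sierpinski_not_baire (R : realType) (f : R -> R) :
  countable_fibres f -> almost_invariant f ->
  ~ baire_property_fun f.
Proof.
move=> fC fI /g_sigma_measurable_ray; move: fC fI.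
apply: (not_measurable_almost_invariant (I := @meager R)).
- exact: countable_meager.
- by move=> A B; exact: meagerS.
- exact: meager_bigcup.
- move=> /(open_meager0 openT) T0.
  by have : [set: R] 0 by []; rewrite T0.
- exact: baire_zero_one.
Qed.

(** * Solvability cardinals do not exceed the successor of the continuum *)
Lemma card_nat_cantor : [set: nat] #<= [set: nat -> bool].
Proof.
apply: (injective_card_le (f := fun m n => m == n)) => m n.
by move=> /(congr1 (@^~ n)); rewrite eqxx => /eqP.
Qed.

(** A sequence is coded by its length, read off from the entries [(i, None)],
    and by the values of its [i]-th term, in the entries [(i, Some j)]. *)
Lemma injective_seq_code (T : Type) (e : T -> nat -> bool) : injective e ->
  exists c : seq T -> nat -> bool, injective c.
Proof.
move=> eI.
exists (fun s k => match choice.unpickle k : option (nat * option nat) with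
  | Some (i, None) => (i < size s)%N
  | Some (i, Some j) => nth (fun=> false) (map e s) i j
  | None => false
  end) => s r sr.
have E p : match p : nat * option nat with
  | (i, None) => (i < size s)%N = (i < size r)%N
  | (i, Some j) => nth (fun=> false) (map e s) i j
                 = nth (fun=> false) (map e r) i j
  end.
  have := congr1 (@^~ (choice.pickle p)) sr.
  by rewrite choice.pickleK; case: p => i [].
apply: (inj_map eI); apply: (@eq_from_nth _ (fun=> false)).
  rewrite !size_map; have := E (size s, None); have := E (size r, None).
  by rewrite !ltnn; case: ltngtP.
by move=> i _; apply/funext => j; exact: (E (i, Some j)).
Qed.

(** An operator is given by a finite sequence of pairs of reals; a pair of binary
    sequences is coded by interleaving. *)
Lemma card_difference_operator (R : realType) :
  [set D | @difference_operator R D] #<= [set: nat -> bool].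
Proof.
have [c cI] : exists c : R -> nat -> bool, injective c.
  by have /pcard_injP[c cI] := card_real_le R; exists c => x y; apply: cI;
    rewrite inE.
pose e (p : R * R) k := c (if odd k then p.2 else p.1) k./2.
have eI : injective e.
  move=> [a b] [a' b'] E; congr pair; apply: cI; apply/funext => k.
    by have := congr1 (@^~ k.*2) E; rewrite /e odd_double doubleK.
  by have := congr1 (@^~ k.*2.+1) E; rewrite /e/= odd_double uphalf_double.
have [d dI] := injective_seq_code eI.
pose op (s : seq (R * R)) (f : R -> R) x := \sum_(p <- s) p.1 * f (x + p.2).
apply: (@card_le_trans _ _ _ [set: seq (R * R)]); last exact: injective_card_le dI.
apply: (@card_le_trans _ _ _ (range op)); last exact: card_image_le.
apply: subset_card_le => _ [n [a [b ->]]].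
exists [seq (a i, b i) | i <- enum 'I_n] => //.
by apply/funext => f; apply/funext => x; rewrite /op big_map big_enum.
Qed.

(** A system whose two-element subsystems are solvable has at most one right-hand
    side for each operator, hence at most continuum many equations: it is one of
    its own small subsystems. The class [F] may be arbitrary. *)
Lemma sc_property_card_succ (R : realType) (F : set (R -> R)) (K : Type) :
  card_lt [set: nat -> bool] [set: K] -> sc_property F K.
Proof.
move=> [cK nKc] S Ssys Ssub.
have small S' : S' `<=` S -> S' #<= [set: nat -> bool] -> solvable_in F S'.
  move=> S'S S'c; apply: Ssub => //; split; first exact: card_le_trans S'c cK.
  by move=> KS'; apply: nKc; exact: card_le_trans KS' S'c.
apply: (small S) => //.
have Sfun D g g' : S (D, g) -> S (D, g') -> g = g'.
  move=> Sg Sg'; have [||f _ fsol] := small [set (D, g); (D, g')].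
  - by move=> p [->|->].
  - apply: (card_le_trans _ card_nat_cantor).
    by apply: finite_set_countable; exact: finite_set2.
  - by rewrite -(fsol D g); [apply: fsol; right|left].
have /pcard_injP[c cI] := card_difference_operator R.
apply/pcard_injP; exists (fun p => c p.1) => -[D g] [D' g'].
rewrite !inE => Sg Sg' /= /cI; rewrite !inE => /(_ (Ssys _ _ Sg) (Ssys _ _ Sg')).
by move=> DD'; subst D'; rewrite (Sfun _ _ _ Sg Sg').
Qed.

(** * An unsolvable system with solvable countable subsystems *)
Definition shift_diff (R : realType) (t : R) (f : R -> R) (x : R) : R :=
  f (x + t) - f x.

Lemma difference_operator_shift_diff (R : realType) (t : R) :
  difference_operator (shift_diff t).
Proof.
exists 2%N, (fun i => if i == ord0 then 1 else -1),
  (fun i => if i == ord0 then t else 0).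
apply/funext => f; apply/funext => x.
by rewrite !big_ord_recl big_ord0/= mul1r mulN1r !addr0.
Qed.

Definition shift_system (R : realType) (f : R -> R) :
    set (((R -> R) -> (R -> R)) * (R -> R)) :=
  range (fun t => (shift_diff t, shift_diff t f)).

(** Let [G] be the countable group generated by the steps occurring in the
    subsystem, and [C] the countable [G]-invariant set of points where some
    translation by [G] changes [f]. Cutting [f] off outside [C] does not affect
    these equations: off [C] both sides vanish. *)
Lemma shift_subsystem_solvable (R : realType) (F : set (R -> R)) (f : R -> R)
    (S' : set (((R -> R) -> (R -> R)) * (R -> R))) :
  (forall h : R -> R, countable [set x | h x <> 0] -> F h) ->
  almost_invariant f -> S' `<=` shift_system f -> countable S' ->
  solvable_in F S'.
Proof.
move=> Fh fI S'S S'C.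
(* The operator with step [t] sends the identity to the constant [t]. *)
pose G := zspan ((fun p => p.1 id 0) @` S').
have GC : countable G.
  by apply: countable_zspan; apply: card_le_trans S'C; exact: card_image_le.
pose C := \bigcup_(t in G) [set x | f (x + t) <> f x].
have CC : countable C by apply: bigcup_countable => // t _; exact: fI.
have CG x s : G s -> C x -> C (x + s).
  move=> Gs [t Gt /= fxt]; apply: contrapT => nC; apply: fxt.
  have fper r : G r -> f (x + s + r) = f (x + s).
    by move=> Gr; apply: contrapT => nf; apply: nC; exists r.
  have -> : f (x + t) = f (x + s).
    by rewrite -(fper (t - s)) ?addrA ?subrK//; [rewrite addrAC addrK|
      apply: zspanD => //; exact: zspanN].
  by rewrite -(fper (- s)) ?addrK//; exact: zspanN.
pose h x := if pselect (C x) then f x else 0.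
exists h.
  apply: Fh; apply: sub_countable CC; apply: subset_card_le => x /=.
  by rewrite /h; case: pselect.
move=> D g Dg; have [t _ [DE gE]] := S'S _ Dg; subst D g.
have Gt : G t.
  apply: sub_zspan; exists (shift_diff t, shift_diff t f) => //=.
  by rewrite /shift_diff subr0 add0r.
apply/funext => x; rewrite /shift_diff /h.
case: pselect => Cxt; case: pselect => Cx //.
- by case: Cx; rewrite -(addrK t x); apply: CG => //; exact: zspanN.
- by case: Cxt; exact: CG.
- rewrite subrr; apply/esym/eqP; rewrite subr_eq0; apply/eqP.
  by apply: contrapT => fxt; apply: Cx; exists t.
Qed.

(** All translation differences determine a function up to an additive constant,
    and adding a constant preserves countable fibres and almost invariance. *)
Lemma shift_system_not_solvable (R : realType) (F : set (R -> R)) (f : R -> R) :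
  (forall h : R -> R, countable_fibres h -> almost_invariant h -> ~ F h) ->
  countable_fibres f -> almost_invariant f ->
  ~ solvable_in F (shift_system f).
Proof.
move=> nF fC fI [h Fh hsol].
have hE x : h x = f x + (h 0 - f 0).
  have : shift_diff x h = shift_diff x f by apply: hsol; exists x.
  move=> /(congr1 (@^~ 0)); rewrite /shift_diff add0r => /eqP.
  by rewrite subr_eq => /eqP ->; rewrite addrAC addrA.
apply: nF Fh => [y|t].
  apply: sub_countable (fC (y - (h 0 - f 0))); apply: subset_card_le => x /= <-.
  by rewrite hE addrK.
apply: sub_countable (fI t); apply: subset_card_le => x /= nh fxt; apply: nh.
by rewrite (hE (x + t)) (hE x) fxt.
Qed.

(** If [K] did not embed into [L], then [L] would be at most the continuum, so
    that the subsystems smaller than [L] would all be countable under the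
    continuum hypothesis, and the system of all translation differences would
    refute the property of [L]. *)
Lemma CH_is_sc (R : realType) (F : set (R -> R)) (K : Type) :
  continuum_hypothesis -> is_card_succ (nat -> bool) K ->
  (forall h : R -> R, countable [set x | h x <> 0] -> F h) ->
  (forall h : R -> R, countable_fibres h -> almost_invariant h -> ~ F h) ->
  is_sc F K.
Proof.
move=> CH [cK succK] Fh nF; split; first exact: sc_property_card_succ.
move=> L scL; apply: contrapT => nKL.
have Lc : [set: L] #<= [set: nat -> bool].
  apply: contrapT => nLc; apply: nKL; apply: succK; split => //.
  exact: (@card_le_of_not_ge (nat -> bool)).
have [f [fC fI]] := CH_sierpinski R CH.
apply: (shift_system_not_solvable nF fC fI); apply: scL.
  by move=> D g [t _ [<- _]]; exact: difference_operator_shift_diff.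
move=> S' S'S [S'L nLS']; apply: (shift_subsystem_solvable Fh fI S'S).
apply: contrapT => nS'; have [N [N0 [_ succN]]] := CH.
apply: nLS'; apply: card_le_trans Lc _.
rewrite -(card_le_eqr (card_setT S')); apply: succN; split.
  rewrite (card_le_eql N0) (card_le_eqr (card_setT S')); apply/infiniteP.
  by move=> /finite_set_countable.
by rewrite (card_le_eqr N0) (card_le_eql (card_setT S')).
Qed.

Theorem corollary8p8 (R : realType) :
  continuum_hypothesis ->
  exists kappa : Type,
    [/\ is_sc [set f : R -> R | lebesgue_measurable_fun f] kappa,
        is_sc [set f : R -> R | baire_property_fun f] kappa,
        is_aleph 2 kappa
      & is_card_succ (nat -> bool) kappa].
Proof.
move=> CH; have [K Ksucc] := exists_card_succ (nat -> bool).
exists K; split => //.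
- apply: CH_is_sc => //; last exact: sierpinski_not_lebesgue_measurable.
  move=> h; apply: countable_support_measurable => B mB.
  by exists B => //; exists set0; [exact: negligible_set0|rewrite setU0].
- apply: CH_is_sc => //; last exact: sierpinski_not_baire.
  by move=> h; apply: countable_support_measurable => B mB; left.
- by exists (nat -> bool).
Qed.
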